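(* Let $\mathcal{H}$ be a separable complex Hilbert space, let $0\neq T\in B(\mathcal{H})$, and suppose that for some $\varphi\in\mathcal{H}$ the series $\sum_{k=0}^{\infty}c_kT^k\varphi$ converges for all $\{c_k\}_{k=0}^{\infty}\in\ell^2(\mathbb{N}_0)$. Let $U:\ell^2(\mathbb{N}_0)\to\mathcal{H}$, $U(\{c_k\}_{k=0}^\infty)=\sum_{k=0}^{\infty}c_kT^k\varphi$, be the synthesis operator. Then $\{T^k\varphi\}_{k=0}^{\infty}$ is a frame sequence for $\mathcal{H}$ if and only if the spectrum of $U^*U|_{N(U)^{\perp}}$ is contained in the half-open interval $]0,\|U\|^2]$. In this case, $$\sigma(U^*U)\subseteq[0,\|U\|^2].$$
   Context: $B(\mathcal{H})$ denotes the bounded linear operators on $\mathcal{H}$, $\mathbb{N}_0=\mathbb{N}\cup\{0\}$, and $\sigma(\cdot)$ denotes the spectrum. $N(U)$ is the null space of $U$ and $N(U)^\perp$ its orthogonal complement in $\ell^2(\mathbb{N}_0)$; $U^*U|_{N(U)^\perp}$ is regarded as an operator $N(U)^\perp\to N(U)^\perp$. (Under the convergence hypothesis $U$ is a well-defined bounded operator.) A sequence $\{f_k\}$ in $\mathcal{H}$ is a frame sequence for $\mathcal{H}$ if there are constants $A,B>0$ with $A\|f\|^2\le\sum_k|\langle f,f_k\rangle|^2\le B\|f\|^2$ for all $f\in\overline{\mathrm{span}}\{f_k\}$. *)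

(* Defs.v *)
From HB Require Import structures.
From mathcomp Require Import all_boot all_order all_algebra.
From mathcomp Require Import complex ring lra.
From mathcomp Require Import all_classical all_reals all_analysis.

Set Implicit Arguments.
Unset Strict Implicit.
Unset Printing Implicit Defensive.

Import Order.TTheory GRing.Theory Num.Theory Num.Def.
Import numFieldNormedType.Exports.

Local Open Scope ring_scope.
Local Open Scope complex_scope.
Local Open Scope classical_set_scope.

Section DotTheory.
Variables (C : numClosedFieldType) (U : lmodType C) (form : {dot U for conjC}).
Local Notation "''[' u , v ]" := (form u v).

Lemma dot_CauchySchwarz u v :
  `|'[u, v]| <= sqrtC '[u, u] * sqrtC '[v, v].
Proof.
rewrite -(@ler_pXn2r _ 2)// ?nnegrE ?mulr_ge0 ?sqrtC_ge0 ?dnorm_ge0//.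
rewrite exprMn !sqrtCK.
have [->|v0] := eqVneq v 0.
  by rewrite linear0r normr0 expr0n mulr_ge0 ?dnorm_ge0.
have v1 : 0 < '[v, v] by rewrite dnorm_gt0.
pose a := '[u, v] / '[v, v]; pose w := u - a *: v.
have wv : '[w, v] = 0.
  by rewrite linearBl/= linearZl_LR divfK ?subrr// gt_eqF.
have -> : u = w + a *: v by rewrite subrK.
rewrite linearDl/= wv add0r linearZl_LR/= normrM exprMn.
rewrite hnormDd/=; last by rewrite linearZr_LR/= wv mulr0.
rewrite dnormZ (ger0_norm (ltW v1)) expr2 mulrA mulrDl lerDr.
by rewrite mulr_ge0// dnorm_ge0.
Qed.

Lemma dot_triangle u v :
  sqrtC '[u + v, u + v] <= sqrtC '[u, u] + sqrtC '[v, v].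
Proof.
rewrite -(@ler_pXn2r _ 2)// ?nnegrE ?addr_ge0 ?sqrtC_ge0 ?dnorm_ge0//.
rewrite sqrrD !sqrtCK dnormD/= addrAC lerD2r lerD2l.
apply: (@le_trans _ _ (`|'[u, v]| *+ 2)); last first.
  by rewrite lerMn2r dot_CauchySchwarz.
have rr : '[u, v] + ('[u, v])^* \is Num.real.
  by rewrite CrealE rmorphD/= conjCK addrC.
apply: (le_trans (real_ler_norm rr)); rewrite (le_trans (ler_normD _ _))//.
by rewrite norm_conjC mulr2n.
Qed.

End DotTheory.

HB.mixin Record NormedModule_isInnerProductSpace (R : realType) V
    & NormedModule R[i] V := {
  inner : {dot V for @Num.conj R[i]} ;
  inner_norm : forall x : V, inner x x = `|x| ^+ 2
}.

#[short(type="innerProductSpaceType")]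
HB.structure Definition InnerProductSpace (R : realType) :=
  {V of NormedModule R[i] V & NormedModule_isInnerProductSpace R V}.

#[short(type="hilbertType")]
HB.structure Definition Hilbert (R : realType) :=
  {V of InnerProductSpace R V & Complete V}.

HB.factory Record Lmodule_isInnerProductSpace (R : realType) V
    & GRing.Lmodule R[i] V := {
  dotp : {dot V for @Num.conj R[i]}
}.

HB.builders Context (R : realType) V & Lmodule_isInnerProductSpace R V.

Let n (x : V) : R[i] := sqrtC (dotp x x).

Let nD x y : n (x + y) <= n x + n y.
Proof. exact: dot_triangle. Qed.

Let nZ (l : R[i]) x : n (l *: x) = `|l| * n x.
Proof.
by rewrite /n dnormZ sqrtCM ?nnegrE ?exprn_ge0 ?dnorm_ge0// sqrCK.
Qed.

Let n0 x : n x = 0 -> x = 0.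
Proof. by move=> /eqP; rewrite sqrt_dnorm_eq0 => /eqP. Qed.

HB.instance Definition _ := Lmodule_isNormed.Build R[i] V nD nZ n0.

Let nK (x : V) : dotp x x = `|x| ^+ 2.
Proof. by rewrite sqrtCK. Qed.

HB.instance Definition _ :=
  NormedModule_isInnerProductSpace.Build R V nK.

HB.end.

(* The norm of a complex normed module takes its values in R[i]; [rnorm] is the
   same norm as a real number. *)
Definition rnorm (R : realType) (V : normedZmodType R[i]) (x : V) : R :=
  complex.Re `|x|.

Section Rnorm.
Variables (R : realType) (V : normedZmodType R[i]).
Implicit Types x y : V.

Lemma rnormE x : (rnorm x)%:C = `|x|.
Proof. by rewrite /rnorm RRe_real// normr_real. Qed.

Lemma rnorm_ge0 x : 0 <= rnorm x.
Proof. by rewrite -ler0c rnormE. Qed.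

Lemma rnorm0 : rnorm (0 : V) = 0.
Proof. by rewrite /rnorm normr0. Qed.

Lemma rnormD x y : rnorm (x + y) <= rnorm x + rnorm y.
Proof. by rewrite -lecR rmorphD/= !rnormE ler_normD. Qed.

End Rnorm.

Section ComplexSeries.
Variable R : realType.
Implicit Types z w : R[i].

Lemma rnormM z w : rnorm (z * w) = rnorm z * rnorm w.
Proof. by apply: (@complexI R); rewrite rmorphM/= !rnormE normrM. Qed.

Lemma rnormJ z : rnorm (Num.conj z) = rnorm z.
Proof. by rewrite /rnorm norm_conjC. Qed.

Lemma rnorm_sqr z : rnorm z ^+ 2 = complex.Re z ^+ 2 + complex.Im z ^+ 2.
Proof. by rewrite /rnorm normc_def/= sqr_sqrtr// addr_ge0 ?sqr_ge0. Qed.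

Lemma Re_le_rnorm z : `|complex.Re z| <= rnorm z.
Proof.
rewrite -(@ler_pXn2r _ 2)// ?nnegrE ?rnorm_ge0// rnorm_sqr.
by rewrite real_normK ?num_real// lerDl sqr_ge0.
Qed.

Lemma Im_le_rnorm z : `|complex.Im z| <= rnorm z.
Proof.
rewrite -(@ler_pXn2r _ 2)// ?nnegrE ?rnorm_ge0// rnorm_sqr.
by rewrite real_normK ?num_real// lerDr sqr_ge0.
Qed.

Lemma rnorm_le_ReIm z : rnorm z <= `|complex.Re z| + `|complex.Im z|.
Proof.
rewrite -(@ler_pXn2r _ 2)// ?nnegrE ?rnorm_ge0 ?addr_ge0// rnorm_sqr.
rewrite sqrrD !real_normK ?num_real// lerD2r lerDl.
by rewrite mulrn_wge0 ?mulr_ge0.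
Qed.

Lemma cvg_complex (u : nat -> R[i]) (a b : R) :
  complex.Re (u n) @[n --> \oo] --> a ->
  complex.Im (u n) @[n --> \oo] --> b ->
  (u : nat -> R[i]^o) @ \oo --> (a +i* b : R[i]^o).
Proof.
move=> ua ub; apply/cvgrPdist_lt => -[e f]; rewrite ltcE/= => /andP[/eqP-> e0].
have e2 : 0 < e / 2 by rewrite divr_gt0.
move/cvgrPdist_lt : ua => /(_ _ e2) ua.
move/cvgrPdist_lt : ub => /(_ _ e2) ub.
near=> n.
rewrite -rnormE ltcR.
apply: (le_lt_trans (rnorm_le_ReIm _)).
rewrite (splitr e) ltrD//.
- by rewrite raddfB/=; near: n.
- by rewrite raddfB/=; near: n.
Unshelve. all: by end_near. Qed.

Lemma sum_Re (u : nat -> R[i]) n :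
  complex.Re (series u n) = series (fun k => complex.Re (u k)) n.
Proof. by rewrite /series/= raddf_sum. Qed.

Lemma sum_Im (u : nat -> R[i]) n :
  complex.Im (series u n) = series (fun k => complex.Im (u k)) n.
Proof. by rewrite /series/= raddf_sum. Qed.

Lemma normed_cvg_complex (u : nat -> R[i]) :
  cvgn (series (fun k => rnorm (u k))) ->
  cvgn (series (u : nat -> R[i]^o)).
Proof.
move=> cu.
have cRe : cvgn (series (fun k => complex.Re (u k))).
  apply: normed_cvg; apply: series_le_cvg cu => // k.
  - exact: normr_ge0.
  - exact: rnorm_ge0.
  - exact: Re_le_rnorm.
have cIm : cvgn (series (fun k => complex.Im (u k))).
  apply: normed_cvg; apply: series_le_cvg cu => // k.
  - exact: normr_ge0.
  - exact: rnorm_ge0.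
  - exact: Im_le_rnorm.
apply/cvg_ex; exists (limn (series (fun k => complex.Re (u k))) +i*
                      limn (series (fun k => complex.Im (u k)))).
apply: cvg_complex.
- under eq_fun do rewrite sum_Re; exact: cRe.
- under eq_fun do rewrite sum_Im; exact: cIm.
Qed.

End ComplexSeries.

Section L2Pred.
Variable R : realType.

Definition square_summable : {pred nat -> R[i]} :=
  [pred c | `[< cvgn (series (fun k => rnorm (c k) ^+ 2)) >]].

Lemma square_summable_submod : submod_closed square_summable.
Proof.
split.
  apply/asboolP.
  rewrite (_ : series _ = fun=> (0 : R)); first exact: is_cvg_cst.
  apply/funext => n; rewrite /series/= big1// => k _.
  by rewrite rnorm0 expr0n.
move=> a c d /asboolP cc /asboolP cd; apply/asboolP.
have cvgS : cvgn (series (fun k =>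
    (rnorm a ^+ 2 *+ 2) * rnorm (c k) ^+ 2 + 2 * rnorm (d k) ^+ 2)).
  rewrite (_ : series _ = (fun n =>
    (rnorm a ^+ 2 *+ 2) * series (fun k => rnorm (c k) ^+ 2) n +
    2 * series (fun k => rnorm (d k) ^+ 2) n)).
    exact: (is_cvgD (is_cvgMl_tmp cc) (is_cvgMl_tmp cd)).
  by apply/funext => n; rewrite /series/= big_split/= !mulr_sumr.
apply: series_le_cvg cvgS => k.
- exact: sqr_ge0.
- by rewrite addr_ge0// mulr_ge0 ?sqr_ge0// mulrn_wge0 ?sqr_ge0.
have h : rnorm ((a *: c + d) k) <= rnorm a * rnorm (c k) + rnorm (d k).
  by rewrite -rnormM; exact: rnormD.
apply: (@le_trans _ _ ((rnorm a * rnorm (c k) + rnorm (d k)) ^+ 2)).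
  by rewrite ler_pXn2r// nnegrE ?rnorm_ge0// addr_ge0 ?mulr_ge0 ?rnorm_ge0.
rewrite -subr_ge0 (_ : _ - _ = (rnorm a * rnorm (c k) - rnorm (d k)) ^+ 2).
  exact: sqr_ge0.
by ring.
Qed.

HB.instance Definition _ :=
  GRing.isSubmodClosed.Build _ _ square_summable square_summable_submod.

End L2Pred.
Arguments square_summable {R}.

Record l2 (R : realType) := L2 {
  l2val :> nat -> R[i] ;
  l2valP : l2val \in square_summable
}.

HB.instance Definition _ (R : realType) := [isSub for @l2val R].
HB.instance Definition _ (R : realType) := [Choice of l2 R by <:].
HB.instance Definition _ (R : realType) :=
  [SubChoice_isSubLmodule of l2 R by <:].

Section L2Dot.
Variable R : realType.
Implicit Types c d : l2 R.

Definition l2_dot c d : R[i] :=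
  limn (series (fun k => c k * Num.conj (d k)) : nat -> R[i]^o).

Lemma l2_cvg c : cvgn (series (fun k => rnorm (c k) ^+ 2)).
Proof. by have /asboolP := l2valP c. Qed.

Lemma l2_dot_cvg c d :
  cvgn (series (fun k => c k * Num.conj (d k)) : nat -> R[i]^o).
Proof.
apply: normed_cvg_complex.
have cvgS : cvgn (series (fun k => rnorm (c k) ^+ 2 + rnorm (d k) ^+ 2)).
  rewrite seriesD; apply: is_cvgD; exact: l2_cvg.
apply: series_le_cvg cvgS => k.
- exact: rnorm_ge0.
- by rewrite addr_ge0 ?sqr_ge0.
rewrite rnormM rnormJ.
have : 0 <= (rnorm (c k) - rnorm (d k)) ^+ 2 by exact: sqr_ge0.
have := rnorm_ge0 (c k); have := rnorm_ge0 (d k); nra.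
Qed.

Let cvgL c d : series (fun k => c k * Num.conj (d k)) @ \oo --> (l2_dot c d : R[i]^o).
Proof. exact: l2_dot_cvg. Qed.

Let hausC : hausdorff_space R[i]^o. Proof. exact: norm_hausdorff. Qed.

Lemma l2_dot_herm c d : l2_dot c d = (-1) ^+ false * Num.conj (l2_dot d c).
Proof.
rewrite expr0 mul1r; apply: (cvg_lim hausC).
have dc := (@cvgrPdist_lt R[i] R[i]^o nat _ _ _ _).1 (@cvgL d c).
apply/cvgrPdist_lt => e /dc; apply: filterS => n.
rewrite -norm_conjC rmorphB/= [in X in X -> _]/series/= rmorph_sum/=.
rewrite /series/=; congr (`|_ - _| < _); apply: eq_bigr => k _.
by rewrite rmorphM/= conjCK mulrC.
Qed.

Lemma l2_dot_linearl d : GRing.linear_for *%R (l2_dot^~ d).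
Proof.
move=> a c c' /=; apply: (cvg_lim hausC).
rewrite (_ : series _ = (fun n => a * series (fun k => c k * Num.conj (d k)) n
   + series (fun k => c' k * Num.conj (d k)) n)).
  apply: (@cvgD R[i] R[i]^o); last exact: cvgL.
  apply: (@cvgZl_tmp R[i] R[i]^o); exact: cvgL.
apply/funext => n; rewrite /series/= mulr_sumr -big_split/=.
by apply: eq_bigr => k _; rewrite mulrDl mulrA.
Qed.

Lemma l2_dotE c :
  l2_dot c c = (limn (series (fun k => rnorm (c k) ^+ 2)))%:C.
Proof.
have dE n : series (fun k => c k * Num.conj (c k)) n =
    (series (fun k => rnorm (c k) ^+ 2) n)%:C.
  rewrite /series/= rmorph_sum/=; apply: eq_bigr => k _.
  by rewrite -normCK -rnormE rmorphXn.
apply: (cvg_lim hausC); apply: cvg_complex.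
- under eq_fun do rewrite dE; exact: l2_cvg.
- under eq_fun do rewrite dE; exact: cvg_cst.
Qed.

Lemma l2_dot_gt0 c : c != 0 -> 0 < l2_dot c c.
Proof.
move=> c0; have [k ck] : exists k, c k != 0.
  apply: contrapT => /forallNP ck; move/eqP: c0; apply.
  by apply/val_inj/funext => k /=; apply/eqP; have /negP := ck k; rewrite negbK.
rewrite l2_dotE (_ : 0 = 0%:C)// ltcR (@lt_le_trans _ _ (rnorm (c k) ^+ 2))//.
  by rewrite exprn_gt0// -ltcR rnormE normr_gt0.
have ndc : nondecreasing_seq (series (fun k => rnorm (c k) ^+ 2)).
  by apply: nondecreasing_series => n _ _; exact: sqr_ge0.
apply: (le_trans _ (nondecreasing_cvgn_le ndc (@l2_cvg c) k.+1)).
by rewrite /series/= big_nat_recr//= lerDr sumr_ge0// => n _; exact: sqr_ge0.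
Qed.

Let l2_dot_bilinear : bilinear_for *%R (Num.conj \; *%R) l2_dot.
Proof.
split=> [d|c]; first exact: l2_dot_linearl.
move=> a d d' /=; rewrite !(l2_dot_herm c) !expr0 !mul1r l2_dot_linearl.
by rewrite rmorphD rmorphM.
Qed.

HB.instance Definition _ :=
  @bilinear_isBilinear.Build R[i] (l2 R) (l2 R) R[i]
    *%R (Num.conj \; *%R) l2_dot l2_dot_bilinear.

HB.instance Definition _ :=
  @isHermitianSesquilinear.Build R[i] (l2 R) false Num.conj l2_dot l2_dot_herm.

HB.instance Definition _ := @isDotProduct.Build R[i] (l2 R) l2_dot l2_dot_gt0.

End L2Dot.

HB.instance Definition _ (R : realType) :=
  Lmodule_isInnerProductSpace.Build R (l2 R) (@l2_dot R : {dot _ for _}).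

Section Orthogonal.
Variables (R : realType) (V : innerProductSpaceType R) (A : set V).

Definition orthogonal_complement : {pred V} :=
  [pred x | `[< forall a, A a -> inner x a = 0 >]].

Lemma orthogonal_complement_submod : submod_closed orthogonal_complement.
Proof.
split; first by apply/asboolP => a _; exact: linear0l.
move=> a x y /asboolP xA /asboolP yA; apply/asboolP => b Ab.
by rewrite linearPl/= xA// yA// mulr0 addr0.
Qed.

HB.instance Definition _ :=
  GRing.isSubmodClosed.Build _ _ orthogonal_complement
    orthogonal_complement_submod.

Record orthspace := OrthSpace {
  orthval :> V ;
  orthvalP : orthval \in orthogonal_complement
}.

HB.instance Definition _ := [isSub for orthval].
HB.instance Definition _ := [Choice of orthspace by <:].
HB.instance Definition _ := [SubChoice_isSubLmodule of orthspace by <:].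

Let norm (x : orthspace) : R[i] := `|val x|.

Let normD x y : norm (x + y) <= norm x + norm y.
Proof. exact: ler_normD. Qed.

Let normZ (l : R[i]) x : norm (l *: x) = `|l| * norm x.
Proof. exact: normrZ. Qed.

Let norm0 x : norm x = 0 -> x = 0.
Proof. by move=> /normr0_eq0 x0; exact: val_inj. Qed.

HB.instance Definition _ :=
  Lmodule_isNormed.Build R[i] orthspace normD normZ norm0.

(* Only meaningful when [f] maps the complement into itself, see
   [orth_restrictE]; points sent outside of it would be mapped to 0. *)
Definition orth_restrict (f : V -> V) (x : orthspace) : orthspace :=
  insubd 0 (f (val x)).

Lemma orth_restrictE (f : V -> V) (x : orthspace) :
  f (val x) \in orthogonal_complement -> val (orth_restrict f x) = f (val x).
Proof. by move=> fx; rewrite val_insubd fx. Qed.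

End Orthogonal.
Arguments orth_restrict {R V} A f x.

Section Operators.
Variable R : realType.

Definition null_space (E F : normedModType R[i]) (f : E -> F) : set E :=
  [set x | f x = 0].

Definition opnorm (E F : normedModType R[i]) (f : E -> F) : R :=
  sup [set rnorm (f x) | x in [set x | rnorm x <= 1]].

(* [xget] picks the unique x with <f z, y> = <z, x> for all z, or 0 if there is
   none; for a bounded linear f between Hilbert spaces it exists for every y. *)
Definition adjoint (E F : innerProductSpaceType R) (f : E -> F) (y : F) : E :=
  xget 0 [set x | forall z, inner (f z) y = inner z x].

Definition resolvent_set (E : normedModType R[i]) (f : E -> E) : set R[i] :=
  [set l | exists g : {linear E -> E}, [/\ continuous g,
     cancel (fun x => f x - l *: x) g & cancel g (fun x => f x - l *: x)]].

Definition spectrum (E : normedModType R[i]) (f : E -> E) : set R[i] :=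
  ~` resolvent_set f.

Lemma adjoint_orth (E F : innerProductSpaceType R) (f : E -> F) (y : F) :
  adjoint f y \in orthogonal_complement (null_space f).
Proof.
rewrite /adjoint; case: xgetP => [x _ /= fx|_]; last exact: rpred0.
apply/asboolP => z fz; rewrite hermC/= expr0 mul1r -fx fz.
by rewrite linear0l rmorph0.
Qed.

End Operators.

Section Frames.
Variable R : realType.

Definition separable_space (T : topologicalType) : Prop :=
  exists2 D : set T, countable D & dense D.

Definition lin_span (V : lmodType R[i]) (f : nat -> V) : set V :=
  [set x | exists n (a : nat -> R[i]), x = \sum_(k < n) a k *: f k].

Definition frame_sequence (H : hilbertType R) (f : nat -> H) : Prop :=
  exists A B : R, [/\ 0 < A, 0 < B & forall x, closure (lin_span f) x ->
    ((A * rnorm x ^+ 2)%:E <=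
       \sum_(0 <= k <oo) (rnorm (inner x (f k)) ^+ 2)%:E <=
     (B * rnorm x ^+ 2)%:E)%E].

Definition synthesis (H : hilbertType R) (f : nat -> H) (c : l2 R) : H :=
  limn (series (fun k => c k *: f k)).

End Frames.

Section L2Norm.
Variable R : realType.

Lemma l2_innerE (c d : l2 R) :
  inner c d = limn (series (fun k => c k * Num.conj (d k)) : nat -> R[i]^o).
Proof. by []. Qed.

Lemma l2_normE (c : l2 R) :
  rnorm c ^+ 2 = limn (series (fun k => rnorm (c k) ^+ 2)).
Proof.
by apply: (@complexI R); rewrite rmorphXn/= rnormE -inner_norm -l2_dotE.
Qed.

End L2Norm.

(* Main.v *)
From HB Require Import structures.
Require Import Defs.
From mathcomp Require Import all_boot all_order all_algebra.
From mathcomp Require Import complex.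
From mathcomp Require Import all_classical all_reals all_analysis.
From mathcomp Require Import ring lra.

Set Implicit Arguments.
Unset Strict Implicit.
Unset Printing Implicit Defensive.

Import Order.TTheory GRing.Theory Num.Theory.
Import numFieldNormedType.Exports.

Local Open Scope ring_scope.
Local Open Scope complex_scope.
Local Open Scope classical_set_scope.

(** Write f_k for the orbit, U for synthesis and V x = (<x, f_k>)_k for analysis.
   Convergence of the series for every square-summable c forces U to be bounded:
   otherwise unit-size partial sums could be produced from blocks of coefficients
   of geometrically small norm and pairwise disjoint supports, and gluing the
   blocks would give a square-summable c whose series is not Cauchy
   ([synthesis_tail_small]).  By duality V is bounded and it is the adjoint of U,
   so that U*U is VU, with quadratic form <VUc, c> = |Uc|^2 lying between 0 and
   M^2 |c|^2, where M = |U|.  The same bounds hold for <UVx, x> = |Vx|^2 on H.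

   A number l outside [0, M^2] can be separated from this interval by a rotation
   ([separating_rotation]), which makes UV - l and VU - l coercive.  Coercivity
   makes UV - l onto, by a Neumann series in the complete space H
   ([lax_milgram]); the identity (VU - l)^-1 = ((V (UV - l)^-1 U) - 1) / l carries
   surjectivity over to VU - l, on l2 and on the orthogonal complement of N(U)
   alike ([VU_shift_onto]).  Hence both spectra always lie in [0, M^2], and the
   equivalence is about the single point 0.

   Let K be the closed span of the f_k.  Being a frame sequence amounts to a lower
   bound A |x|^2 <= |Vx|^2 on K, that is, to coercivity of UV on K.  If it holds,
   UV maps K onto K; it follows that every c orthogonal to N(U) is Vx with x in K,
   hence equals VUVx' with x' in K, and that |Uc|^2 >= A |c|^2, so VU is invertible
   on the complement of N(U) ([frame_resolvent0]).  Conversely, if VU has a bounded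
   inverse there and x is in K, then Vx = VUc for some c with |c| <= L |Vx|; as V
   is injective on K, x = Uc, and |x|^2 = <Uc, x> = <c, Vx> <= L |Vx|^2
   ([resolvent0_frame]). *)

(** * Real-valued norms, limits and closures *)

Section RealNorm.
Variables (R : realType) (E : normedModType R[i]).
Implicit Types (x y : E) (a : R[i]).

Lemma rnormZ a x : rnorm (a *: x) = rnorm a * rnorm x.
Proof. by apply: (@complexI R); rewrite rmorphM/= !rnormE normrZ. Qed.

Lemma rnormN x : rnorm (- x) = rnorm x.
Proof. by rewrite /rnorm normrN. Qed.

Lemma rnorm_gt0 x : (0 < rnorm x) = (x != 0).
Proof. by rewrite -(ltcR 0) rnormE normr_gt0. Qed.

Lemma rnorm_eq0 x : (rnorm x == 0) = (x == 0).
Proof. by rewrite -(inj_eq (@complexI R)) rnormE normr_eq0. Qed.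

Lemma rnorm_le0_eq0 x : rnorm x <= 0 -> x = 0.
Proof. by move=> x0; apply/eqP; rewrite -rnorm_eq0 eq_le x0 rnorm_ge0. Qed.

Lemma rnorm_real (r : R) : rnorm (r%:C) = `|r|.
Proof. by apply: (@complexI R); rewrite rnormE normc_def/= expr0n addr0 sqrtr_sqr. Qed.

Lemma rnorm_sum (I : Type) (s : seq I) (P : pred I) (F : I -> E) :
  rnorm (\sum_(k <- s | P k) F k) <= \sum_(k <- s | P k) rnorm (F k).
Proof.
elim/big_rec2: _ => [|k r x _ h]; first by rewrite rnorm0.
by apply: le_trans (rnormD _ _) _; rewrite lerD2l.
Qed.

(** Norms take values in R[i], whose order is only partial; with real epsilons,
    estimates can be carried out in R. *)
Lemma rcvgP (u : nat -> E) (l : E) :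
  u @ \oo --> l <->
  forall e : R, 0 < e -> \forall n \near \oo, rnorm (l - u n) < e.
Proof.
split=> [/cvgrPdist_lt ul e e0|ul].
  have /ul : 0 < e%:C by rewrite (ltcR 0).
  by apply: filterS => n; rewrite -rnormE ltcR.
apply/cvgrPdist_lt => -[e f]; rewrite ltcE/= => /andP[/eqP-> /ul].
by apply: filterS => n; rewrite -rnormE ltcR.
Qed.

Lemma closureP (A : set E) x :
  closure A x <-> forall e : R, 0 < e -> exists2 y, A y & rnorm (x - y) < e.
Proof.
split=> [xA e e0|xA B /nbhs_ballP[[e f]]].
  have e0' : 0 < e%:C :> R[i] by rewrite (ltcR 0).
  have [y [Ay]] := xA _ (nbhsx_ballx x e%:C e0').
  by rewrite -ball_normE /= -rnormE ltcR => xy; exists y.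
rewrite /= ltcE/= => /andP[/eqP-> /xA[y Ay xy]] eB; exists y; split=> //.
by apply: eB; rewrite -ball_normE /= -rnormE ltcR.
Qed.

End RealNorm.

Section InnerProduct.
Variables (R : realType) (E : innerProductSpaceType R).
Implicit Types (x y z : E) (a : R[i]).

Lemma inner_conj x y : inner x y = Num.conj (inner y x).
Proof. by rewrite hermC/= expr0 mul1r. Qed.

Lemma inner_rnorm x : inner x x = (rnorm x ^+ 2)%:C.
Proof. by rewrite inner_norm -rnormE rmorphXn. Qed.

Lemma rnorm_inner x y : rnorm (inner x y) <= rnorm x * rnorm y.
Proof.
rewrite -lecR rnormE rmorphM/= !rnormE.
by apply: le_trans (dot_CauchySchwarz _ _ _) _; rewrite !inner_norm !sqrCK.
Qed.

Lemma rnorm_subZ_sqr x z (w : R[i]) :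
  rnorm (x - w *: z) ^+ 2 =
  rnorm x ^+ 2 - 2 * complex.Re (w * inner z x) + rnorm w ^+ 2 * rnorm z ^+ 2.
Proof.
apply: (@complexI R); rewrite -inner_rnorm dnormB/= dnormZ !inner_rnorm -rnormE.
rewrite linearZr_LR/= (inner_conj x z) -rmorphM/=.
case: (w * inner z x) => a b; apply/eqP; rewrite eq_complex/=.
apply/andP; split; apply/eqP; rewrite ?(expr2, mulr0, mul0r); ring.
Qed.

End InnerProduct.

(** * Coercive operators on a closed subspace *)

Lemma geometric_series_cvg (R : realType) (H : hilbertType R) (u : nat -> H)
    (C q : R) :
  0 <= q -> q < 1 -> (forall n, rnorm (u n) <= C * q ^+ n) ->
  cvgn (series u).
Proof.
move=> q0 q1 uq.
have cvg_dom : cvgn (series (fun n => rnorm (u n))).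
  apply: (@series_le_cvg _ _ (geometric C q)) => [n|n|n|].
  - exact: rnorm_ge0.
  - by rewrite /geometric/= (le_trans (rnorm_ge0 _) (uq n)).
  - exact: uq.
  - by apply: is_cvg_geometric_series; rewrite ger0_norm.
have /cauchy_cvgP/cauchy_seriesP cauchy_dom := cvg_dom.
apply/cauchy_cvgP/cauchy_seriesP => -[e f]; rewrite ltcE/= => /andP[/eqP-> e0].
have := cauchy_dom e e0; apply: filterS => -[m n] /= h.
rewrite -rnormE ltcR; apply: le_lt_trans h.
apply: le_trans (rnorm_sum _ _ _) _.
by rewrite ger0_norm// sumr_ge0// => k _; exact: rnorm_ge0.
Qed.

Lemma lim_bounded_linear (R : realType) (E F : normedModType R[i])
  (f : {linear E -> F}) (L : R) (u : nat -> E) (l : E) :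
  (forall x, rnorm (f x) <= L * rnorm x) ->
  u @ \oo --> l -> (f \o u) @ \oo --> f l.
Proof.
move=> fL /rcvgP ul; apply/rcvgP => e e0.
have L1 : 0 < `|L| + 1 by rewrite ltr_wpDl.
have := ul (e / (`|L| + 1)) (divr_gt0 e0 L1); apply: filterS => n un.
rewrite /= -raddfB; apply: le_lt_trans (fL _) _.
apply: (@le_lt_trans _ _ ((`|L| + 1) * rnorm (l - u n))).
  by rewrite ler_wpM2r ?rnorm_ge0// (le_trans (ler_norm L))// lerDl.
by rewrite mulrC -ltr_pdivlMr.
Qed.

(** A small multiple w of the rotated operator makes 1 - wF a contraction of K, so
    the Neumann series of (1 - wF)^n (w y) converges, within K, to a preimage
    of y.  Restricting coercivity to K covers both F = UV - l on the whole space
    and F = UV on the closed span of a frame sequence. *)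
Lemma lax_milgram (R : realType) (H : hilbertType R) (K : set H)
    (F : {linear H -> H}) (L d : R) (t : R[i]) :
  (forall a x y, K x -> K y -> K (a *: x + y)) -> closed K ->
  (forall x, K x -> K (F x)) ->
  (forall x, rnorm (F x) <= L * rnorm x) ->
  0 < d ->
  (forall x, K x -> d * rnorm x ^+ 2 <= complex.Re (t * inner (F x) x)) ->
  forall y, K y -> exists2 x, K x & F x = y.
Proof.
move=> Klin Kcl KF FL d0 Fd y Ky.
have [y0|yn0] := eqVneq y 0.
  by exists 0; rewrite ?linear0// -y0.
have K0 : K 0 by have := Klin (-1) _ _ Ky Ky; rewrite scaleN1r addNr.
have KD x z : K x -> K z -> K (x + z) by rewrite -{2}[x]scale1r; exact: Klin.
have KZ a x : K x -> K (a *: x) by move=> Kx; rewrite -[_ *: x]addr0; exact: Klin.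
have t0 : t != 0.
  apply/eqP => t0; have := Fd y Ky; rewrite t0 mul0r /= leNgt => /negP; apply.
  by rewrite mulr_gt0// exprn_gt0// rnorm_gt0.
(* With w = e t, |x - wFx|^2 <= (1 - 2 e d + e^2 N) |x|^2, so e N <= d brings the
   factor down to 1 - e d; the extra d^2 + 1 in the denominator of e only
   ensures that this number is positive. *)
pose N : R := (rnorm t * L) ^+ 2.
pose e : R := d / (N + d ^+ 2 + 1).
have N0 : 0 <= N by exact: sqr_ge0.
have den0 : 0 < N + d ^+ 2 + 1 by nra.
have e0 : 0 < e by rewrite divr_gt0.
have eN : e * N <= d by rewrite /e mulrAC ler_pdivrMr//; nra.
have ed : e * d < 1 by rewrite /e mulrAC ltr_pdivrMr//; nra.
pose w := e%:C * t.
have wn0 : w != 0.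
  rewrite mulf_neq0//; apply/eqP => /(congr1 (@complex.Re R)) /= ee.
  by move: e0; rewrite ee ltxx.
pose q := Num.sqrt (1 - e * d).
have q0 : 0 <= q by exact: sqrtr_ge0.
have qE : q ^+ 2 = 1 - e * d by rewrite sqr_sqrtr// subr_ge0 ltW.
have q1 : q < 1.
  by rewrite -(@ltr_pXn2r _ 2)// ?nnegrE// qE expr1n gtrBl mulr_gt0.
have contr x : K x -> rnorm (x - w *: F x) <= q * rnorm x.
  move=> Kx; rewrite -(@ler_pXn2r _ 2)// ?nnegrE ?mulr_ge0 ?rnorm_ge0//.
  rewrite rnorm_subZ_sqr exprMn qE.
  have -> : complex.Re (w * inner (F x) x) = e * complex.Re (t * inner (F x) x).
    rewrite /w -mulrA; case: (t * _) => a b /=; ring.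
  have rw : rnorm w = e * rnorm t by rewrite rnormM rnorm_real gtr0_norm.
  have FLx : rnorm (F x) ^+ 2 <= L ^+ 2 * rnorm x ^+ 2.
    rewrite -exprMn ler_pXn2r// ?nnegrE ?rnorm_ge0//.
    exact: le_trans (rnorm_ge0 _) (FL x).
  have h1 : e * (d * rnorm x ^+ 2) <= e * complex.Re (t * inner (F x) x).
    by rewrite ler_pM2l// Fd.
  have h2 : rnorm w ^+ 2 * rnorm (F x) ^+ 2 <= e * d * rnorm x ^+ 2.
    apply: (@le_trans _ _ (e * (e * N) * rnorm x ^+ 2)).
      rewrite rw /N; have -> : e * (e * (rnorm t * L) ^+ 2) * rnorm x ^+ 2 =
        (e * rnorm t) ^+ 2 * (L ^+ 2 * rnorm x ^+ 2) by ring.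
      by rewrite ler_wpM2l// sqr_ge0.
    by rewrite ler_wpM2r ?sqr_ge0// ler_pM2l.
  lra.
pose u n := iter n (fun x => x - w *: F x) (w *: y).
have Ku n : K (u n).
  elim: n => [|n IH]; first exact: KZ.
  by rewrite /u iterS -/(u n) -scaleNr; apply: KD => //; apply: KZ; exact: KF.
have uq n : rnorm (u n) <= rnorm (w *: y) * q ^+ n.
  elim: n => [|n IH]; first by rewrite expr0 mulr1.
  rewrite {1}/u iterS -/(u n) exprS mulrCA; apply: le_trans (contr _ (Ku n)) _.
  by rewrite ler_wpM2l.
have us : cvgn (series u) by exact: geometric_series_cvg uq.
have Kseries n : K (series u n).
  by rewrite /series/=; elim/big_ind: _ => // i _; exact: KD.
(* The partial sums telescope: u n is the residual after n terms. *)
have Fs n : w *: F (series u n) = w *: y - u n.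
  elim: n => [|n IH].
    by rewrite /series/= big_geq// linear0 scaler0 subrr.
  rewrite seriesSr linearD scalerDr IH /u iterS -/(u n).
  by rewrite opprB addrA addrAC.
have u0 : u @ \oo --> (0 : H) by exact: cvg_series_cvg_0.
exists (limn (series u)).
  by apply: (closed_cvg K) us => //; exact: nearW.
apply: (scalerI wn0).
have h1 : (fun n => w *: F (series u n)) @ \oo --> w *: F (limn (series u)).
  exact: cvgZl_tmp (lim_bounded_linear FL us).
have h2 : (fun n => w *: F (series u n)) @ \oo --> w *: y.
  under eq_fun do rewrite Fs.
  have := cvgB (@cvg_cst _ (w *: y) _ \oo _) u0; rewrite subr0; exact.
exact: (cvg_unique (@norm_hausdorff _ _) h1 h2).
Qed.

(** * Boundedness of the partial sums *)

Lemma square_summable_bounded (R : realType) (c : nat -> R[i]) (M : R) :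
  (forall n, series (fun k => rnorm (c k) ^+ 2) n <= M) ->
  c \in square_summable.
Proof.
move=> cM; apply/asboolP; apply: nondecreasing_is_cvgn.
  by apply: nondecreasing_series => n _ _; exact: sqr_ge0.
by exists M => _ [n _ <-].
Qed.

Lemma sqrD_le2 (R : realType) (x y : R) :
  (x + y) ^+ 2 <= 2 * x ^+ 2 + 2 * y ^+ 2.
Proof. by have := sqr_ge0 (x - y); nra. Qed.

Section PartialSums.
Variables (R : realType) (H : hilbertType R) (f : nat -> H).
Hypothesis fcvg : forall c : l2 R, cvgn (series (fun k => c k *: f k)).

(** The gliding hump.  If arbitrarily small coefficients beyond every index n
    could produce a sum of norm at least 1, blocks of squared norm at most
    2^-j with consecutive supports could be glued into a single
    square-summable sequence whose series fails the Cauchy criterion. *)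
Lemma synthesis_tail_small : exists n (e : R), 0 < e /\
  forall m (a : nat -> R[i]),
  \sum_(n <= k < m) rnorm (a k) ^+ 2 <= e ->
  rnorm (\sum_(n <= k < m) a k *: f k) < 1.
Proof.
apply: contrapT => large.
have /choice[g gP] : forall p : nat * nat, exists q : nat * (nat -> R[i]),
    \sum_(p.1 <= k < q.1) rnorm (q.2 k) ^+ 2 <= (2^-1 : R) ^+ p.2 /\
    1 <= rnorm (\sum_(p.1 <= k < q.1) q.2 k *: f k).
  move=> [n j]; apply: contrapT => nex; apply: large.
  exists n, (2^-1 ^+ j); split=> [|m a ale]; first by rewrite exprn_gt0.
  rewrite ltNge; apply/negP => alarge; apply: nex; by exists (m, a).
(* Block j has support [N j, N j.+1[ and coefficients b j. *)
pose N := fix N j : nat := if j is j'.+1 then (g (N j', j')).1 else 0%N.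
pose b j := (g (N j, j)).2.
have Nsmall j : \sum_(N j <= k < N j.+1) rnorm (b j k) ^+ 2 <= (2^-1 : R) ^+ j.
  by have [] := gP (N j, j).
have Nlarge j : 1 <= rnorm (\sum_(N j <= k < N j.+1) b j k *: f k).
  by have [] := gP (N j, j).
have Nlt j : (N j < N j.+1)%N.
  rewrite ltnNge; apply/negP => NN; have := Nlarge j.
  by rewrite big_geq// rnorm0 ler10.
have Nmono : {homo N : i j / (i <= j)%N}.
  by apply: homo_leq => // [i j k|i]; [exact: leq_trans|exact: ltnW].
have Nge j : (j <= N j)%N by elim: j => // j; move/leq_ltn_trans; apply.
(* The sum selects the unique block whose support contains k; its number is at
   most k because j <= N j. *)
pose c k : R[i] := \sum_(0 <= j < k.+1) (if (N j <= k < N j.+1)%N then b j k else 0).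
have cE j k : (N j <= k < N j.+1)%N -> c k = b j k.
  move=> /andP[jk kj]; have jk' : (j < k.+1)%N by rewrite ltnS (leq_trans (Nge j)).
  rewrite /c big_mkord (bigD1 (Ordinal jk'))//= jk kj big1 ?addr0// => i ij.
  case: ifP => // /andP[ik ki]; move: ij; rewrite -val_eqE/= neq_ltn => /orP[] h.
  - by have := leq_trans (Nmono _ _ h) jk; rewrite leqNgt ki.
  - by have := leq_trans (Nmono _ _ h) ik; rewrite leqNgt kj.
have csum J : series (fun k => rnorm (c k) ^+ 2) (N J) <= 2 * (1 - 2^-1 ^+ J).
  elim: J => [|J IH]; first by rewrite /series/= big_geq// expr0 subrr mulr0.
  rewrite /series/= (@big_cat_nat _ _ _ (N J))//=; last exact: ltnW.
  rewrite [X in _ + X](_ : _ = \sum_(N J <= k < N J.+1) rnorm (b J k) ^+ 2); last first.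
    by apply: eq_big_nat => k kJ; rewrite (cE _ _ kJ).
  have := Nsmall J; move: IH; rewrite /series/= exprS => h1 h2.
  lra.
have cl2 : c \in square_summable.
  apply: (@square_summable_bounded _ _ 2) => n.
  have mono : nondecreasing_seq (series (fun k => rnorm (c k) ^+ 2)).
    by apply: nondecreasing_series => k _ _; exact: sqr_ge0.
  apply: le_trans (mono _ _ (Nge n)) _; apply: le_trans (csum n) _.
  have : 0 <= (2^-1 : R) ^+ n by rewrite exprn_ge0.
  lra.
have ccvg : cvgn (series (fun k => c k *: f k)) := @fcvg (L2 cl2).
have /cauchy_cvgP/cauchy_seriesP/(_ 1 ltr01) := ccvg.
case=> -[A B] /= [[n1 _ An] [n2 _ Bn]] AB.
pose J := maxn n1 n2.
have h := AB (N J, N J.+1).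
have : `|\sum_(N J <= k < N J.+1) c k *: f k| < 1.
  apply: h; split=> /=.
  - by apply: An => /=; apply: leq_trans (Nge J); exact: leq_maxl.
  - apply: Bn => /=; apply: leq_trans (Nge J.+1); apply: leqW; exact: leq_maxr.
rewrite -rnormE -(rmorph1 (real_complex R)) ltcR ltNge => /negP; apply.
rewrite (_ : \sum_(_ <= k < _) _ = \sum_(N J <= k < N J.+1) b J k *: f k)//.
by apply: eq_big_nat => k kJ; rewrite (cE _ _ kJ).
Qed.

(** Finitely many terms are bounded whatever the f_k are; quantifying over all
    m <= n lets the estimate also serve partial sums that stop within the head. *)
Lemma synthesis_head_bounded n : exists2 C : R, 0 <= C & forall m, (m <= n)%N ->
  forall a : nat -> R[i],
  rnorm (\sum_(0 <= k < m) a k *: f k) ^+ 2 <=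
    C * \sum_(0 <= k < m) rnorm (a k) ^+ 2.
Proof.
elim: n => [|n [C C0 IH]].
  by exists 0 => // m; rewrite leqn0 => /eqP-> a; rewrite !big_geq// rnorm0 expr0n mulr0.
have fn0 := sqr_ge0 (rnorm (f n)).
exists (2 * C + 2 * rnorm (f n) ^+ 2) => [|m mn a]; first by lra.
have S0 p : 0 <= \sum_(0 <= k < p) rnorm (a k) ^+ 2.
  by apply: sumr_ge0 => k _; exact: sqr_ge0.
move: mn; rewrite leq_eqVlt => /predU1P[->|]; last first.
  rewrite ltnS => mn; apply: le_trans (IH m mn a) _.
  rewrite ler_wpM2r//; lra.
rewrite !big_nat_recr//=.
have h := IH n (leqnn n) a; move: h (S0 n).
set s := \sum_(_ <= _ < _) rnorm _ ^+ 2; set v := \sum_(_ <= _ < _) _ *: _.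
move=> h s0.
have h1 : rnorm (v + a n *: f n) ^+ 2 <= (rnorm v + rnorm (a n) * rnorm (f n)) ^+ 2.
  rewrite ler_pXn2r// ?nnegrE ?rnorm_ge0// ?addr_ge0 ?mulr_ge0 ?rnorm_ge0//.
  by rewrite -rnormZ rnormD.
apply: le_trans h1 _; apply: le_trans (sqrD_le2 _ _) _.
have := sqr_ge0 (rnorm (a n)); rewrite exprMn; nra.
Qed.

(** Homogeneity turns the smallness of tails into a linear bound, and the head
    is finite-dimensional.  This is the uniform boundedness principle for the
    partial synthesis operators. *)
Lemma partial_synthesis_bounded : exists2 C : R, 0 <= C &
  forall m (a : nat -> R[i]),
  rnorm (\sum_(0 <= k < m) a k *: f k) ^+ 2 <=
    C * \sum_(0 <= k < m) rnorm (a k) ^+ 2.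
Proof.
have [n [e [e0 tail]]] := synthesis_tail_small.
have tailS m (a : nat -> R[i]) :
    rnorm (\sum_(n <= k < m) a k *: f k) ^+ 2 <=
      e^-1 * \sum_(n <= k < m) rnorm (a k) ^+ 2.
  set S := \sum_(_ <= k < _) rnorm _ ^+ 2.
  have S0 : 0 <= S by apply: sumr_ge0 => k _; exact: sqr_ge0.
  apply/ler_addgt0Pr => d d0.
  (* Scaling by sqrt (e / s) makes the squared norm of the coefficients less than
     e; taking s slightly above S covers the case S = 0. *)
  pose s := S + d * e; have s0 : 0 < s by rewrite ltr_wpDl// mulr_gt0.
  pose r := Num.sqrt (e / s).
  have rE : r ^+ 2 = e / s by rewrite sqr_sqrtr// divr_ge0// ltW.
  have r0 : 0 < r by rewrite sqrtr_gt0 divr_gt0.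
  have : rnorm (\sum_(n <= k < m) (r%:C * a k) *: f k) < 1.
    apply: tail; under eq_bigr do rewrite rnormM rnorm_real exprMn (gtr0_norm r0).
    rewrite -mulr_sumr rE -/S mulrAC ler_pdivrMr// ler_pM2l// lerDl.
    by rewrite mulr_ge0// ltW.
  under eq_bigr do rewrite -scalerA.
  rewrite -scaler_sumr rnormZ rnorm_real gtr0_norm//.
  set v := rnorm _ => h.
  have h2 : (r * v) ^+ 2 <= 1.
    by rewrite -(expr1n _ 2) ler_pXn2r// ?nnegrE ?mulr_ge0 ?rnorm_ge0 ?ltW.
  move: h2; rewrite exprMn rE mulrAC ler_pdivrMr// mul1r => h2.
  have -> : e^-1 * S + d = s / e by rewrite /s; field; rewrite gt_eqF.
  by rewrite ler_pdivlMr// mulrC.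
have [C C0 head] := synthesis_head_bounded n.
have e0' : 0 <= e^-1 by rewrite invr_ge0 ltW.
have S0 (a : nat -> R[i]) q p : 0 <= \sum_(q <= k < p) rnorm (a k) ^+ 2.
  by apply: sumr_ge0 => k _; exact: sqr_ge0.
exists (2 * (C + e^-1)) => [|m a]; first by lra.
have [mn|/ltnW nm] := leqP m n.
  apply: le_trans (head m mn a) _; rewrite ler_wpM2r//; lra.
rewrite !(@big_cat_nat _ _ _ n 0 m)//=.
have := tailS m a; have := head n (leqnn n) a; move: (S0 a 0%N n) (S0 a n m).
set s1 := \sum_(_ <= _ < _) rnorm _ ^+ 2; set v1 := \sum_(_ <= _ < _) _ *: _.
set s2 := \sum_(_ <= _ < _) rnorm _ ^+ 2; set v2 := \sum_(_ <= _ < _) _ *: _.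
move=> s10 s20 h1 h2.
have h3 : rnorm (v1 + v2) ^+ 2 <= (rnorm v1 + rnorm v2) ^+ 2.
  by rewrite ler_pXn2r// ?nnegrE ?rnorm_ge0// ?addr_ge0 ?rnorm_ge0// rnormD.
apply: le_trans h3 _; apply: le_trans (sqrD_le2 _ _) _; nra.
Qed.

End PartialSums.

(** * Operator norms, coercivity and resolvents *)

Lemma rnorm_lim_le (R : realType) (E : normedModType R[i]) (u : nat -> E)
  (l : E) (B : R) :
  u @ \oo --> l -> (forall n, rnorm (u n) <= B) -> rnorm l <= B.
Proof.
move=> /rcvgP ul uB; apply/ler_addgt0Pr => e /ul [n _ un].
rewrite -(subrK (u n) l) (le_trans (rnormD _ _))// addrC lerD// ltW//.
by apply: un => /=.
Qed.

Lemma opnorm_bounded (R : realType) (E F : normedModType R[i])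
  (g : {linear E -> F}) (C : R) : 0 <= C ->
  (forall x, rnorm (g x) <= C * rnorm x) ->
  0 <= opnorm g /\ forall x, rnorm (g x) <= opnorm g * rnorm x.
Proof.
move=> C0 gC; rewrite /opnorm; set A := image _ _.
have ubA : has_ubound A.
  exists C => _ [x /= x1 <-]; apply: le_trans (gC x) _.
  by rewrite ler_piMr.
have g0 : 0 <= sup A.
  apply: ub_le_sup => //; exists 0; rewrite /= ?rnorm0 ?linear0 ?rnorm0//.
split=> // x; have [->|x0] := eqVneq x 0.
  by rewrite linear0 !rnorm0 mulr0.
have x1 : 0 < rnorm x by rewrite rnorm_gt0.
rewrite -ler_pdivrMr// mulrC.
have -> : (rnorm x)^-1 * rnorm (g x) = rnorm (g ((rnorm x)^-1%:C *: x)).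
  by rewrite linearZ/= rnormZ rnorm_real ger0_norm// invr_ge0 ltW.
apply: ub_le_sup => //; exists ((rnorm x)^-1%:C *: x) => //=.
by rewrite rnormZ rnorm_real ger0_norm ?invr_ge0 ?(ltW x1)// mulVf ?gt_eqF.
Qed.

(** Multiplication by t turns the segment from 0 to M, seen from l, into the open
    right half-plane: a quarter turn if l is not real, the identity if l < 0
    and a half turn if l > M.  The factor n stands for |x|^2, and s for the value
    at x of a quadratic form with values in [0, M |x|^2]. *)
Lemma separating_rotation (R : realType) (M : R) (l : R[i]) :
  ~ [set r%:C | r in `[0, M]] l ->
  exists (t : R[i]) (d : R), 0 < d /\
    forall s n, 0 <= s -> s <= M * n -> 0 <= n ->
    d * n <= complex.Re (t * (s%:C - l * n%:C)).
Proof.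
case: l => a b lM; have [b0|b0] := eqVneq b 0; last first.
  exists (0 +i* b), (b ^+ 2); split; first by rewrite exprn_even_gt0.
  by move=> s n _ _ _ /=; rewrite le_eqVlt; apply/orP; left; apply/eqP; ring.
have : ~~ (0 <= a <= M).
  apply/negP => aM; apply: lM; exists a; last by rewrite b0.
  by rewrite /= in_itv.
rewrite negb_and -!ltNge => /orP[a0|Ma].
- exists 1, (- a); split; first by rewrite oppr_gt0.
  by move=> s n s0 _ n0 /=; lra.
- exists (-1), (a - M); split; first by rewrite subr_gt0.
  by move=> s n _ sn n0 /=; lra.
Qed.

Lemma coercive_lower_bound (R : realType) (E : innerProductSpaceType R) (d : R)
  (t : R[i]) (x z : E) :
  0 < d -> d * rnorm x ^+ 2 <= complex.Re (t * inner z x) ->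
  rnorm x <= rnorm t / d * rnorm z.
Proof.
move=> d0 dx; have [->|x0] := eqVneq x 0.
  by rewrite rnorm0 !mulr_ge0 ?invr_ge0 ?rnorm_ge0 ?ltW.
have {}x0 : 0 < rnorm x by rewrite rnorm_gt0.
rewrite -mulrA mulrCA ler_pdivlMl// -(ler_pM2r x0) -mulrA -expr2.
apply: le_trans dx _; apply: le_trans (ler_norm _) _.
apply: le_trans (Re_le_rnorm _) _; rewrite rnormM -mulrA.
by rewrite ler_wpM2l ?rnorm_ge0// rnorm_inner.
Qed.

Lemma linear_rnorm_continuous (R : realType) (E F : normedModType R[i])
  (g : {linear E -> F}) (L : R) :
  (forall x, rnorm (g x) <= L * rnorm x) -> continuous g.
Proof.
move=> gL; apply: bounded_linear_continuous; apply/linear_boundedP.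
exists (L%:C); split; first by rewrite complex_real.
move=> r Lr x; rewrite -!rnormE; apply: (@le_trans _ _ (L%:C * (rnorm x)%:C)).
  by rewrite -rmorphM/= lecR.
apply: ler_wpM2r; [by rewrite ler0c rnorm_ge0|exact: ltW].
Qed.

Lemma continuous_rnorm_linear (R : realType) (E F : normedModType R[i])
  (g : {linear E -> F}) :
  continuous g -> exists2 L : R, 0 < L & forall x, rnorm (g x) <= L * rnorm x.
Proof.
move/linear_bounded_continuous/linear_boundedP/pinfty_ex_gt0 => [[L b]].
rewrite ltcE /= => /andP[/eqP-> L0] gL; exists L => // x.
by rewrite -lecR rmorphM/= !rnormE.
Qed.

(** The lower bound gives injectivity and continuity of the inverse at once. *)
Lemma bijective_resolvent (R : realType) (E : normedModType R[i]) (g : E -> E)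
  (l : R[i]) (C : R) :
  linear g -> (forall y, exists x, g x - l *: x = y) ->
  (forall x, rnorm x <= C * rnorm (g x - l *: x)) -> resolvent_set g l.
Proof.
move=> glin /choice[h hP] gC; set F := fun x => g x - l *: x.
have Flin : linear F.
  by move=> a x y; rewrite /F glin !scalerDr scalerA mulrC -scalerA scalerN opprD addrACA.
pose FL : {linear E -> E} := HB.pack F (GRing.isLinear.Build _ _ _ _ F Flin).
have Finj : injective F.
  move=> x y xy; apply/eqP; rewrite -subr_eq0; apply/eqP/rnorm_le0_eq0.
  apply: le_trans (gC _) _; rewrite -/(F (x - y)) -[F]/(FL : E -> E) raddfB.
  by rewrite /FL/= xy subrr rnorm0 mulr0.
have Fh : cancel h F by exact: hP.
have hF : cancel F h by move=> x; exact/Finj/Fh.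
have hlin : linear h.
  by move=> a x y; apply: Finj; rewrite Flin !Fh.
pose hL : {linear E -> E} := HB.pack h (GRing.isLinear.Build _ _ _ _ h hlin).
exists hL; split=> //.
apply: (@linear_rnorm_continuous _ _ _ hL C) => y.
by rewrite /hL/=; apply: le_trans (gC _) _; rewrite -/(F (h y)) Fh.
Qed.

Lemma orth_restrict_linear (R : realType) (V : innerProductSpaceType R)
  (A : set V) (g : V -> V) : linear g ->
  (forall x, x \in orthogonal_complement A ->
     g x \in orthogonal_complement A) ->
  linear (orth_restrict A g).
Proof.
move=> glin gA a x y; apply: val_inj.
have gN (z : orthspace A) : g (val z) \in orthogonal_complement A.
  by apply: gA; exact: valP.
rewrite orth_restrictE// [RHS]linearP/= !orth_restrictE//.
by rewrite -glin; congr g; exact: linearP.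
Qed.

Lemma rnorm_val (R : realType) (V : innerProductSpaceType R) (A : set V)
  (x : orthspace A) : rnorm x = rnorm (val x).
Proof. by []. Qed.

(** * Synthesis, analysis and their compositions *)

(** Defaulting to 0 makes this a total function of f; the coefficients are
    square-summable as soon as the synthesis series always converge, see
    [analysis_opE]. *)
Definition analysis_op (R : realType) (H : hilbertType R) (f : nat -> H) (y : H)
  : l2 R := insubd 0 (fun k => inner y (f k)).

Section Synthesis.
Variables (R : realType) (H : hilbertType R) (f : nat -> H).
Hypothesis fcvg : forall c : l2 R, cvgn (series (fun k => c k *: f k)).

Local Notation U := (synthesis f).
Local Notation V := (analysis_op f).
Local Notation M := (opnorm (synthesis f)).

Lemma synthesis_cvg (c : l2 R) : series (fun k => c k *: f k) @ \oo --> U c.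
Proof. exact: fcvg. Qed.

Lemma synthesis_linear : linear U.
Proof.
move=> a c d; apply: (cvg_lim (@norm_hausdorff _ _)).
have -> : series (fun k => (a *: c + d) k *: f k) =
    (fun n => a *: series (fun k => c k *: f k) n + series (fun k => d k *: f k) n).
  apply/funext => n; rewrite /series/= scaler_sumr -big_split/=.
  by apply: eq_bigr => k _; rewrite scalerDl scalerA.
apply: cvgD; last exact: synthesis_cvg.
by apply: cvgZl_tmp; exact: synthesis_cvg.
Qed.

HB.instance Definition _ := GRing.isLinear.Build R[i] (l2 R) H _ U synthesis_linear.

Lemma l2_partial_le (c : l2 R) n :
  \sum_(0 <= k < n) rnorm (c k) ^+ 2 <= rnorm c ^+ 2.
Proof.
rewrite l2_normE; apply: (nondecreasing_cvgn_le _ (@l2_cvg _ c) n).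
by apply: nondecreasing_series => k _ _; exact: sqr_ge0.
Qed.

Lemma synthesis_bounded :
  0 <= M /\ forall c, rnorm (U c) <= M * rnorm c.
Proof.
have [C C0 fC] := partial_synthesis_bounded fcvg.
apply: (@opnorm_bounded _ _ _ _ (Num.sqrt C)) => [|c]; first exact: sqrtr_ge0.
apply: (@rnorm_lim_le _ _ _ (U c) _ (@synthesis_cvg c)) => n.
rewrite -(@ler_pXn2r _ 2)// ?nnegrE ?mulr_ge0 ?rnorm_ge0 ?sqrtr_ge0//.
rewrite exprMn sqr_sqrtr//; apply: le_trans (fC n c) _.
by rewrite ler_wpM2l// l2_partial_le.
Qed.

(** Bessel's inequality by duality: if S is the sum of the first n squared
    coefficients of y, then S = <y, v> with v the partial synthesis of these
    coefficients, so S^2 <= |y|^2 |v|^2 <= C |y|^2 S. *)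
Lemma analysis_opE y k : V y k = inner y (f k).
Proof.
rewrite /analysis_op; rewrite -[X in X = _]/(l2val _ k) val_insubd ifT//.
have [C C0 fC] := partial_synthesis_bounded fcvg.
apply: (@square_summable_bounded _ _ (C * rnorm y ^+ 2)) => n.
have := fC n (fun k => inner y (f k)); rewrite /series/=.
set S := \sum_(_ <= _ < _) _ ^+ 2; set v := \sum_(_ <= _ < _) _ => h.
have S0 : 0 <= S by apply: sumr_ge0 => j _; exact: sqr_ge0.
have Sv : S%:C = inner y v.
  rewrite /S /v linear_sumr/= rmorph_sum; apply: eq_bigr => j _.
  by rewrite linearZr_LR/= mulrC -normCK -rnormE rmorphXn.
have Sle : S <= rnorm y * rnorm v.
  by rewrite -[S]ger0_norm// -rnorm_real Sv rnorm_inner.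
have y0 := rnorm_ge0 y; have v0 := rnorm_ge0 v.
have : S * S <= (C * rnorm y ^+ 2) * S.
  apply: (@le_trans _ _ ((rnorm y * rnorm v) * (rnorm y * rnorm v))).
    exact: ler_pM.
  have -> : rnorm y * rnorm v * (rnorm y * rnorm v) = rnorm y ^+ 2 * rnorm v ^+ 2.
    by ring.
  by rewrite mulrC [leRHS]mulrAC ler_wpM2r// sqr_ge0.
have [->|Sn0] := eqVneq S 0; first by rewrite mulr_ge0// sqr_ge0.
by rewrite ler_pM2r// lt_neqAle eq_sym Sn0.
Qed.

Lemma inner_synthesis c y : inner (U c) y = inner c (V y).
Proof.
rewrite l2_innerE; apply/esym/(@cvg_lim R[i]^o (@norm_hausdorff _ R[i]^o)).
have := @synthesis_cvg c => /rcvgP Uc.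
apply/(@rcvgP _ R[i]^o) => e e0.
have y1 : 0 < rnorm y + 1 by rewrite ltr_wpDl// rnorm_ge0.
have := Uc (e / (rnorm y + 1)) (divr_gt0 e0 y1); apply: filterS => n un.
have -> : series (fun k => c k * Num.conj (V y k)) n =
    inner (series (fun k => c k *: f k) n) y.
  rewrite /series/= linear_sumlz/=; apply: eq_bigr => k _.
  by rewrite linearZl_LR/= analysis_opE (inner_conj (f k)).
rewrite -linearBl/=; apply: le_lt_trans (rnorm_inner _ _) _.
rewrite ltr_pdivlMr// in un; apply: le_lt_trans un.
by rewrite ler_wpM2l ?rnorm_ge0// lerDl.
Qed.

(** V y represents z |-> <Uz, y>, and the inner product determines the
    representing vector uniquely. *)
Lemma adjoint_synthesis : adjoint U = V.
Proof.
apply/funext => y; rewrite /adjoint.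
case: xgetP => [x _ /= ex|/(_ (V y))]; last first.
  by case=> c; exact: inner_synthesis.
apply/eqP; rewrite -subr_eq0 -rnorm_eq0 -(@eqrXn2 _ 2)// ?rnorm_ge0// expr0n.
rewrite -(inj_eq (@complexI R)) -inner_rnorm linearBr/= -inner_synthesis ex subrr.
by [].
Qed.

Lemma analysis_linear : linear V.
Proof.
move=> a x y; apply: val_inj; apply/funext => k /=.
rewrite -[RHS]/(a * V x k + V y k).
by rewrite -[LHS]/(V (a *: x + y) k) !analysis_opE linearPl.
Qed.

HB.instance Definition _ := GRing.isLinear.Build R[i] H (l2 R) _ V analysis_linear.

Lemma inner_UV y : inner (U (V y)) y = (rnorm (V y) ^+ 2)%:C.
Proof. by rewrite inner_synthesis inner_rnorm. Qed.

Lemma inner_VU c : inner (V (U c)) c = (rnorm (U c) ^+ 2)%:C.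
Proof. by rewrite inner_conj -inner_synthesis -inner_conj inner_rnorm. Qed.

Lemma analysis_bounded y : rnorm (V y) <= M * rnorm y.
Proof.
have [M0 UM] := synthesis_bounded.
have [->|V0] := eqVneq (V y) 0; first by rewrite rnorm0 mulr_ge0 ?rnorm_ge0.
have {}V0 : 0 < rnorm (V y) by rewrite rnorm_gt0.
rewrite -(ler_pM2r V0) -expr2.
have -> : rnorm (V y) ^+ 2 = complex.Re (inner (U (V y)) y) by rewrite inner_UV.
apply: le_trans (ler_norm _) _; apply: le_trans (Re_le_rnorm _) _.
apply: le_trans (rnorm_inner _ _) _; rewrite mulrAC.
by rewrite ler_wpM2r ?rnorm_ge0.
Qed.

Lemma analysis_esum y :
  (\sum_(0 <= k <oo) (rnorm (inner y (f k)) ^+ 2)%:E)%E = (rnorm (V y) ^+ 2)%:E.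
Proof.
rewrite l2_normE; under eq_eseriesr do rewrite -analysis_opE.
apply: cvg_lim => //.
rewrite (_ : (fun n => _) = EFin \o (series (fun k => rnorm (V y k) ^+ 2))); last first.
  by apply/funext => n; rewrite /series/= sumEFin.
by apply: cvg_comp (@l2_cvg _ (V y)) _.
Qed.

Local Notation Nperp := (orthogonal_complement (null_space (synthesis f))).
Local Notation K := (closure (lin_span f)).

Lemma analysis_orth y : V y \in Nperp.
Proof. by rewrite -adjoint_synthesis//; exact: adjoint_orth. Qed.

Lemma VU_linear : linear (V \o U).
Proof. by move=> a x y; rewrite /= !linearP. Qed.

Lemma VU_orth_linear : linear (orth_restrict (null_space U) (V \o U)).
Proof. by apply: orth_restrict_linear VU_linear _ => x _; exact: analysis_orth. Qed.

Lemma VU_orthE (c : orthspace (null_space U)) :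
  val (orth_restrict (null_space U) (V \o U) c) = V (U (val c)).
Proof. by rewrite orth_restrictE//; exact: analysis_orth. Qed.

Lemma VU_orth_shiftE l (c : orthspace (null_space U)) :
  val (orth_restrict (null_space U) (V \o U) c - l *: c) =
  V (U (val c)) - l *: val c.
Proof. by rewrite linearB linearZ/= VU_orthE. Qed.

Lemma synthesis_sqr_le (c : l2 R) : rnorm (U c) ^+ 2 <= M ^+ 2 * rnorm c ^+ 2.
Proof.
have [M0 UM] := synthesis_bounded.
by rewrite -exprMn ler_pXn2r// nnegrE ?mulr_ge0 ?rnorm_ge0.
Qed.

Lemma analysis_sqr_le y : rnorm (V y) ^+ 2 <= M ^+ 2 * rnorm y ^+ 2.
Proof.
have [M0 _] := synthesis_bounded.
rewrite -exprMn ler_pXn2r// ?nnegrE ?mulr_ge0 ?rnorm_ge0//.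
exact: analysis_bounded.
Qed.

(** * Points off the interval from 0 to the squared norm *)

Section OffSpectrum.
Variable l : R[i].
Hypothesis lM : ~ [set r%:C | r in `[0, M ^+ 2]] l.

Lemma UV_shift_onto y : exists x, U (V x) - l *: x = y.
Proof.
have [M0 UM] := synthesis_bounded.
have Flin : linear (fun x => U (V x) - l *: x).
  move=> a x z; rewrite [V _]linearP [U _]linearP scalerDr scalerBr opprD addrACA.
  by rewrite !scalerA mulrC.
pose F : {linear H -> H} := HB.pack (fun x => U (V x) - l *: x)
  (GRing.isLinear.Build _ _ _ _ (fun x => U (V x) - l *: x) Flin).
have [t [d [d0 td]]] := separating_rotation lM.
have [x _ xy] : exists2 x, setT x & F x = y; last by exists x.
apply: (@lax_milgram _ _ setT F (M * M + rnorm l) d t) => //.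
- move=> x; rewrite mulrDl -rnormZ; apply: le_trans (rnormD _ _) _.
  rewrite rnormN lerD2r -mulrA; apply: le_trans (UM _) _.
  by rewrite ler_wpM2l// analysis_bounded.
- move=> x _; rewrite linearBl/= linearZl_LR/= inner_UV// inner_rnorm.
  by apply: td; rewrite ?sqr_ge0// analysis_sqr_le.
Qed.

(** The preimage d comes from the identity
    (VU - l)^-1 = ((V (UV - l)^-1 U) - 1) / l, which reduces solvability on l2 to
    solvability on the complete space H.  Its explicit form shows that d stays
    orthogonal to N(U) when c is. *)
Lemma VU_shift_onto c : exists x, let d := l^-1 *: (V x - c) in
  V (U d) - l *: d = c.
Proof.
have l0 : l != 0.
  apply/eqP => l0; apply: lM; exists 0; rewrite ?l0//=.
  by rewrite in_itv/= lexx sqr_ge0.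
have [x xc] := UV_shift_onto (U c); exists x => /=.
have := congr1 V xc; rewrite linearB linearZ/= => VUc.
rewrite scalerA divff// scale1r [U _]linearZ [V _]linearZ/= [U _]linearB [V _]linearB/=.
rewrite -VUc opprB addrCA subrr addr0 scalerA mulVf// scale1r.
by rewrite opprB addrC subrK.
Qed.

Lemma VU_shift_bounded : exists C : R, forall c,
  rnorm c <= C * rnorm (V (U c) - l *: c).
Proof.
have [t [d [d0 td]]] := separating_rotation lM.
exists (rnorm t / d) => c; apply: coercive_lower_bound d0 _.
rewrite linearBl/= linearZl_LR/= inner_VU// inner_rnorm.
by apply: td; rewrite ?sqr_ge0// synthesis_sqr_le.
Qed.

Lemma VU_resolvent : resolvent_set (V \o U) l.
Proof.
have [C VUC] := VU_shift_bounded.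
apply: (bijective_resolvent VU_linear _ VUC) => c.
by have [x xc] := VU_shift_onto c; eexists; exact: xc.
Qed.

Lemma VU_orth_resolvent :
  resolvent_set (orth_restrict (null_space U) (V \o U)) l.
Proof.
have [C VUC] := VU_shift_bounded.
apply: (@bijective_resolvent _ _ _ _ C VU_orth_linear) => c; last first.
  by rewrite !rnorm_val VU_orth_shiftE; exact: VUC.
have [x /= xc] := VU_shift_onto (val c).
have dperp : l^-1 *: (V x - val c) \in Nperp.
  by rewrite rpredZ// rpredB ?analysis_orth// (valP c).
by exists (OrthSpace dperp); apply: val_inj; rewrite VU_orth_shiftE.
Qed.

End OffSpectrum.

(** * The point 0 and the lower frame bound *)

Lemma lin_span_submod (a : R[i]) x y :
  lin_span f x -> lin_span f y -> lin_span f (a *: x + y).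
Proof.
move=> [n [b ->]] [m [c ->]].
exists (maxn n m), (fun k => a * (if (k < n)%N then b k else 0) +
                        (if (k < m)%N then c k else 0)).
have pad p (e : nat -> R[i]) : (p <= maxn n m)%N ->
    \sum_(k < p) e k *: f k =
    \sum_(k < maxn n m) (if (k < p)%N then e k else 0) *: f k.
  move=> pm; rewrite (big_ord_widen _ (fun k => e k *: f k) pm) big_mkcond/=.
  by apply: eq_bigr => k _; case: ifP => // _; rewrite scale0r.
rewrite (pad n b) ?leq_maxl// (pad m c) ?leq_maxr// scaler_sumr -big_split/=.
by apply: eq_bigr => k _; rewrite scalerDl scalerA.
Qed.

Lemma closure_span_submod (a : R[i]) x y : K x -> K y -> K (a *: x + y).
Proof.
move=> /closureP Kx /closureP Ky; apply/closureP => e e0.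
have a1 : 0 < rnorm a + 1 by rewrite ltr_wpDl// rnorm_ge0.
have [|x' sx' xx'] := Kx (e / 2 / (rnorm a + 1)); first by rewrite !divr_gt0.
have [|y' sy' yy'] := Ky (e / 2); first by rewrite divr_gt0.
exists (a *: x' + y'); first exact: lin_span_submod.
rewrite opprD addrACA -scalerBr (splitr e); apply: le_lt_trans (rnormD _ _) _.
rewrite ltr_leD// ?(ltW yy')// rnormZ; move: xx'; rewrite ltr_pdivlMr//.
by apply: le_lt_trans; rewrite mulrC ler_wpM2l ?rnorm_ge0// lerDl.
Qed.

Lemma synthesis_in_closure_span c : K (U c).
Proof.
apply/closureP => e e0.
have /rcvgP/(_ e e0)[n _ Un] := @synthesis_cvg c.
exists (series (fun k => c k *: f k) n); last exact: Un (leqnn n).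
by exists n, c; rewrite /series/= big_mkord.
Qed.

(** A vector x killed by V is orthogonal to all f_k, hence to vectors
    arbitrarily close to x. *)
Lemma analysis_inj x : K x -> V x = 0 -> x = 0.
Proof.
move=> /closureP Kx Vx; apply: rnorm_le0_eq0; apply/ler_addgt0Pr => e e0.
rewrite add0r; have [y [n [a ->]] xy] := Kx e e0.
have xs : inner x (\sum_(k < n) a k *: f k) = 0.
  rewrite linear_sumr/= big1// => k _.
  by rewrite linearZr_LR/= -analysis_opE// Vx mulr0.
have [->|x0] := eqVneq x 0; first by rewrite rnorm0 ltW.
rewrite -(ler_pM2l (_ : 0 < rnorm x)) ?rnorm_gt0//.
apply: le_trans (ler_wpM2l (rnorm_ge0 x) (ltW xy)).
apply: le_trans (rnorm_inner _ _); rewrite linearBr/= xs subr0 inner_rnorm.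
by rewrite rnorm_real ger0_norm ?sqr_ge0// expr2.
Qed.

(** The upper frame bound is the boundedness of V. *)
Lemma frame_sequence_lower_boundP : frame_sequence f <->
  exists2 A : R, 0 < A & forall x, K x -> A * rnorm x ^+ 2 <= rnorm (V x) ^+ 2.
Proof.
split=> [[A [B [A0 _ AB]]]|[A A0 AV]].
  exists A => // x /AB/andP[+ _].
  by rewrite analysis_esum lee_fin.
exists A, (M ^+ 2 + 1); split=> //.
  by rewrite ltr_wpDl// sqr_ge0.
move=> x Kx; rewrite analysis_esum !lee_fin AV//=.
by rewrite (le_trans (analysis_sqr_le x))// ler_wpM2r ?sqr_ge0// lerDl.
Qed.

Lemma frame_UV_onto A : 0 < A ->
  (forall x, K x -> A * rnorm x ^+ 2 <= rnorm (V x) ^+ 2) ->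
  forall y, K y -> exists2 x, K x & U (V x) = y.
Proof.
move=> A0 AV y Ky; have [M0 UM] := synthesis_bounded.
have Flin : linear (U \o V) by move=> a x z; rewrite /= !linearP.
pose F : {linear H -> H} :=
  HB.pack (U \o V) (GRing.isLinear.Build _ _ _ _ (U \o V) Flin).
apply: (@lax_milgram _ _ K F (M * M) A 1) => //.
- exact: closure_span_submod.
- exact: closed_closure.
- by move=> x _; exact: synthesis_in_closure_span.
- move=> x; rewrite -mulrA; apply: le_trans (UM _) _.
  by rewrite ler_wpM2l// analysis_bounded.
- by move=> x Kx; rewrite mul1r inner_UV//= AV.
Qed.

(** Under a lower frame bound, V maps the closed span onto the complement of N(U):
    solving UVx = Uc in the closed span places c - Vx both in N(U) and in its
    orthogonal complement. *)
Lemma frame_orth_analysis A : 0 < A ->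
  (forall x, K x -> A * rnorm x ^+ 2 <= rnorm (V x) ^+ 2) ->
  forall c, c \in Nperp -> exists2 x, K x & c = V x.
Proof.
move=> A0 AV c cN; have [x Kx Ux] := frame_UV_onto A0 AV (@synthesis_in_closure_span c).
exists x => //; have /asboolP/(_ (c - V x)) : c - V x \in Nperp.
  by rewrite rpredB ?analysis_orth.
move=> h; apply/eqP; rewrite -subr_eq0; apply/eqP.
have : inner (c - V x) (c - V x) = 0 by apply: h; rewrite /null_space/= linearB/= Ux subrr.
rewrite inner_rnorm => /(congr1 (@complex.Re R))/= /eqP.
by rewrite sqrf_eq0 rnorm_eq0 => /eqP.
Qed.

(** Write c = Vx with x = UVx' and both x, x' in the closed span: then VU(Vx') = c.
    The lower bound |Uc|^2 >= A |c|^2 comes from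
    |c|^2 = <Uc, x> <= |Uc| |x| and A |x|^2 <= |c|^2. *)
Lemma frame_resolvent0 A : 0 < A ->
  (forall x, K x -> A * rnorm x ^+ 2 <= rnorm (V x) ^+ 2) ->
  resolvent_set (orth_restrict (null_space U) (V \o U)) 0.
Proof.
move=> A0 AV.
apply: (@bijective_resolvent _ _ _ _ (rnorm (1 : R[i]) / A) VU_orth_linear) => c.
  have [x Kx cx] := frame_orth_analysis A0 AV (valP c).
  have [y Ky yx] := frame_UV_onto A0 AV Kx.
  exists (OrthSpace (analysis_orth y)); apply: val_inj.
  by rewrite scale0r subr0 VU_orthE /= yx.
rewrite scale0r subr0 !rnorm_val VU_orthE; apply: coercive_lower_bound => //.
rewrite mul1r inner_VU//=.
have [x Kx cx] := frame_orth_analysis A0 AV (valP c).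
have := AV x Kx; rewrite -cx.
have : rnorm (val c) ^+ 2 <= rnorm (U (val c)) * rnorm x.
  have -> : rnorm (val c) ^+ 2 = rnorm (inner (U (val c)) x).
    by rewrite inner_synthesis// -cx inner_rnorm rnorm_real ger0_norm ?sqr_ge0.
  exact: rnorm_inner.
move: (rnorm_ge0 (val c)) (rnorm_ge0 (U (val c))) (rnorm_ge0 x).
set p := rnorm (val c); set q := rnorm (U _); set r := rnorm x => p0 q0 r0 h1 h2.
have [->|pn0] := eqVneq p 0; first by rewrite expr0n mulr0 sqr_ge0.
have {}p0 : 0 < p ^+ 2 by rewrite exprn_gt0// lt_neqAle eq_sym pn0.
rewrite -(ler_pM2r p0).
apply: (@le_trans _ _ (A * (q * r) ^+ 2)).
  rewrite -mulrA ler_pM2l// -expr2 ler_pXn2r// nnegrE ?(ltW p0)// mulr_ge0//.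
rewrite exprMn mulrCA; apply: ler_wpM2l => //; exact: sqr_ge0.
Qed.

(** For x in the closed span, inverting VU at Vx yields c with VUc = Vx, and
    injectivity of V on the closed span gives x = Uc.  Then
    |x|^2 = <c, Vx> <= L |Vx|^2. *)
Lemma resolvent0_frame :
  resolvent_set (orth_restrict (null_space U) (V \o U)) 0 ->
  exists2 A : R, 0 < A & forall x, K x -> A * rnorm x ^+ 2 <= rnorm (V x) ^+ 2.
Proof.
move=> [g [gcont Sg gS]]; have [L L0 gL] := continuous_rnorm_linear gcont.
exists L^-1 => [|x Kx]; first by rewrite invr_gt0.
pose c := g (OrthSpace (analysis_orth x)).
have Vc : V (U (val c)) = V x.
  have := gS (OrthSpace (analysis_orth x)); rewrite -/c scale0r subr0.
  by move/(congr1 val); rewrite VU_orthE.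
have xE : x = U (val c).
  apply/eqP; rewrite -subr_eq0; apply/eqP/analysis_inj; last by rewrite linearB/= Vc subrr.
  by rewrite addrC -scaleN1r; apply: closure_span_submod => //; exact: synthesis_in_closure_span.
have cL : rnorm (val c) <= L * rnorm (V x) by exact: gL.
rewrite ler_pdivrMl//.
have -> : rnorm x ^+ 2 = rnorm (inner (val c) (V x)).
  by rewrite -inner_synthesis// -xE inner_rnorm rnorm_real ger0_norm ?sqr_ge0.
apply: le_trans (rnorm_inner _ _) _.
by rewrite expr2 mulrA ler_wpM2r ?rnorm_ge0.
Qed.

End Synthesis.

Theorem proposition2p3 (R : realType) (H : hilbertType R)
    (Hsep : separable_space H)
    (T : {linear H -> H}) (Tcont : continuous T) (T0 : (T : H -> H) <> \0)
    (phi : H)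
    (Ucvg : forall c : l2 R, cvgn (series (fun k => c k *: iter k T phi))) :
  let f := fun k => iter k T phi in
  let U := synthesis f in
  let UU := adjoint U \o U in
  (frame_sequence f <->
     spectrum (orth_restrict (null_space U) UU) `<=`
       [set r%:C | r in `]0, opnorm U ^+ 2]])
  /\ (frame_sequence f ->
     spectrum UU `<=` [set r%:C | r in `[0, opnorm U ^+ 2]]).
Proof.
move=> f U UU.
have fcvg : forall c : l2 R, cvgn (series (fun k => c k *: f k)) by exact: Ucvg.
rewrite /UU /U adjoint_synthesis//; split; first split.
- move=> /(frame_sequence_lower_boundP fcvg)[A A0 AV] l lspec.
  have [r r0M rl] : [set r%:C | r in `[0, opnorm (synthesis f) ^+ 2]] l.
    by apply: contrapT => lM; apply: lspec; exact: VU_orth_resolvent.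
  exists r => //; move: r0M; rewrite /= !in_itv/= => /andP[r0 ->].
  rewrite andbT lt_neqAle r0 andbT; apply/eqP => r00; apply: lspec.
  by rewrite -rl -r00; exact: frame_resolvent0 AV.
- move=> spec; apply/(frame_sequence_lower_boundP fcvg)/(resolvent0_frame fcvg).
  apply: contrapT => /spec[r]; rewrite /= in_itv/= => /andP[r0 _].
  by move=> /(congr1 (@complex.Re R))/= rE; rewrite rE ltxx in r0.
- by move=> _ l lspec; apply: contrapT => lM; apply: lspec; exact: VU_resolvent.
Qed.
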